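(* Let $J$ be an M-convex set on $[n]$ and let $\kappa\in\mathbb{Z}_{\ge 0}^n$. Then $\mathrm{Ret}_\kappa(J)$ is a $\kappa$-caged M-convex set (i.e. the set of bases of a $\kappa$-caged polymatroid).
   Context: Let $[n]=\{1,\dots,n\}$, let $e_i$ be the $i$-th standard basis vector of $\mathbb{Z}^n$, let $|\alpha|=\alpha_1+\cdots+\alpha_n$, and order $\mathbb{Z}^n$ coordinatewise. Let $\Delta_n^r=\{\alpha\in\mathbb{Z}_{\ge0}^n : |\alpha|=r\}$. A nonempty set $J\subseteq\Delta_n^r$ is an M-convex set of rank $r$ on $[n]$ if for all $\alpha,\beta\in J$ and $i\in[n]$ with $\alpha_i<\beta_i$ there is $j\in[n]$ with $\alpha_j>\beta_j$ such that $\alpha+e_i-e_j\in J$ and $\beta-e_i+e_j\in J$. M-convex sets are exactly the sets of bases of (discrete) polymatroids and are identified with polymatroids. $J$ is $\kappa$-caged if $\alpha\le\kappa$ for every $\alpha\in J$. For $v\in\mathbb{Z}_{\ge0}^n$, $\mathrm{proj}_\kappa(v)$ is the vector with coordinates $\min(v_i,\kappa_i)$, and $\mathrm{proj}_\kappa(X)=\{\mathrm{proj}_\kappa(v): v\in X\}$ for a set $X$. The $\kappa$-retraction $\mathrm{Ret}_\kappa(J)$ is the set of coordinatewise maximal elements of $\mathrm{proj}_\kappa(J)$. *)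

(* Defs.v *)
From mathcomp Require Import all_boot all_order all_algebra.
From mathcomp Require Import classical_sets.

Set Implicit Arguments.
Unset Strict Implicit.
Unset Printing Implicit Defensive.

Import Order.TTheory GRing.Theory Num.Theory.

Local Open Scope ring_scope.
Local Open Scope classical_set_scope.

(* Vectors of Z^n are row vectors 'rV[int]_n, with coordinates indexed by
   'I_n = {0, ..., n-1} instead of {1, ..., n}. *)

Definition basis_vec n (i : 'I_n) : 'rV[int]_n := delta_mx 0 i.

Definition weight n (a : 'rV[int]_n) : int := \sum_(i < n) a 0 i.

Definition le_vec n (a b : 'rV[int]_n) : Prop := forall i, a 0 i <= b 0 i.

Definition Delta n (r : nat) : set 'rV[int]_n :=
  [set a | le_vec 0 a /\ weight a = r%:Z].

Definition Mconvex_rank n (r : nat) (J : set 'rV[int]_n) : Prop :=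
  [/\ J !=set0,
      J `<=` Delta r
    & forall a b, J a -> J b -> forall i : 'I_n, a 0 i < b 0 i ->
      exists j : 'I_n,
        [/\ a 0 j > b 0 j,
            J (a + basis_vec i - basis_vec j)
          & J (b - basis_vec i + basis_vec j)]].

Definition Mconvex n (J : set 'rV[int]_n) : Prop :=
  exists r : nat, Mconvex_rank r J.

Definition caged n (k : 'rV[int]_n) (J : set 'rV[int]_n) : Prop :=
  forall a, J a -> le_vec a k.

Definition proj_vec n (k v : 'rV[int]_n) : 'rV[int]_n :=
  \row_(i < n) Num.min (v 0 i) (k 0 i).

Definition maximal_elements n (X : set 'rV[int]_n) : set 'rV[int]_n :=
  [set v | X v /\ forall w, X w -> le_vec v w -> w = v].

Definition Ret n (k : 'rV[int]_n) (J : set 'rV[int]_n) : set 'rV[int]_n :=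
  maximal_elements (proj_vec k @` J).

(* Main.v *)
Require Import Defs.
From mathcomp Require Import all_boot all_order all_algebra.
From mathcomp Require Import classical_sets.
From mathcomp Require Import zify.

(** Write p = proj_k a and q = proj_k b for a, b in J, and suppose p is
    maximal in proj_k J.  If p_i < q_i then a_i < k_i and a_i < b_i, so the
    exchange axiom in J provides j with a_j > b_j.  Moving a by e_i - e_j
    really increases its i-th projected coordinate; if a_j exceeded k_j nothing
    would be lost at j, contradicting maximality of p.  Hence b_j < a_j <= k_j
    ([maximal_exchange_capped]), and this one inequality does all the work:

    - moving b by e_j - e_i gains one unit of projected weight at j and loses at
      most one at i, while b comes closer to a.  Induction on the distance
      from a to b shows that no point of proj_k J is heavier than p
      ([weight_proj_le_maximal]).  So the maximal elements of proj_k J are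
      exactly its elements of greatest weight, and they share one weight;

    - if q is maximal too, both p + e_i - e_j and q - e_i + e_j lie below
      projections of points of J, and they already have the greatest weight,
      so they are equal to these projections and are maximal.  As
      p_j = a_j > b_j = q_j, the same j serves for the exchange of p and q. *)

Set Implicit Arguments.
Unset Strict Implicit.
Unset Printing Implicit Defensive.

Import Order.TTheory GRing.Theory Num.Theory.

Local Open Scope ring_scope.

Lemma exchangeE n (a : 'rV[int]_n) i j l :
  (a + basis_vec i - basis_vec j) 0 l
    = a 0 l + (l == i)%:R - (l == j)%:R.
Proof. by rewrite !mxE eqxx. Qed.

Lemma weight_basis_vec n (i : 'I_n) : weight (basis_vec i) = 1.
Proof.
rewrite /weight (bigD1 i) //= big1 => [|l /negPf li]; rewrite !mxE ?eqxx //.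
by rewrite li.
Qed.

Lemma weight_exchange n (a : 'rV[int]_n) i j :
  weight (a + basis_vec i - basis_vec j) = weight a.
Proof.
have -> : weight (a + basis_vec i - basis_vec j)
    = weight a + weight (basis_vec i) - weight (basis_vec j).
  rewrite /weight -big_split -sumrB /=.
  by apply: eq_bigr => l _; rewrite !mxE.
by rewrite !weight_basis_vec addrK.
Qed.

Lemma weight_le n (a b : 'rV[int]_n) : le_vec a b -> weight a <= weight b.
Proof. by move=> ab; apply: ler_sum. Qed.

Lemma le_vec_weight_eq n (a b : 'rV[int]_n) :
  le_vec a b -> weight b <= weight a -> b = a.
Proof.
move=> ab ba; apply/rowP => l; apply/le_anti; rewrite ab andbT.
apply: contraLR ba; rewrite -!ltNge => abl.
rewrite /weight (bigD1 l) //= [X in _ < X](bigD1 l) //=.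
by rewrite ltr_leD // ler_sum.
Qed.

Definition dist n (a b : 'rV[int]_n) : nat :=
  (\sum_(l < n) `|(a 0 l - b 0 l)%R|)%N.

Lemma dist_exchange n (a b : 'rV[int]_n) (i j : 'I_n) :
    a 0 i < b 0 i -> b 0 j < a 0 j ->
  (dist a (b + basis_vec j - basis_vec i) < dist a b)%N.
Proof.
move=> abi baj.
have step l : (`|(a 0 l - (b + basis_vec j - basis_vec i) 0 l)%R|
                 + (l == i) <= `|(a 0 l - b 0 l)%R|)%N.
  rewrite exchangeE.
  by have [->|_] := eqVneq l i; have [?|_] := eqVneq _ j; subst; lia.
rewrite /dist (bigD1 i) //= [X in (_ < X)%N](bigD1 i) //=.
have := step i; rewrite eqxx addn1 => Hi.
rewrite -addSn leq_add // leq_sum // => l _.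
exact: leq_trans (leq_addr _ _) (step l).
Qed.

Section Retraction.
Variables (n : nat) (k : 'rV[int]_n).
Implicit Types (a b : 'rV[int]_n) (i j : 'I_n).

Local Notation proj := (proj_vec k).

Lemma proj_vecE a l : proj a 0 l = Num.min (a 0 l) (k 0 l).
Proof. by rewrite mxE. Qed.

(** Only an inequality: when a_j > k_j, the unit removed at j was not visible
    in the projection. *)
Lemma proj_exchange_ge a i j : a 0 i < k 0 i ->
  le_vec (proj a + basis_vec i - basis_vec j)
         (proj (a + basis_vec i - basis_vec j)).
Proof.
move=> aki l; rewrite proj_vecE !exchangeE proj_vecE.
by have [->|_] := eqVneq l i; have [?|_] := eqVneq _ j; subst; lia.
Qed.

Lemma weight_proj_exchange a i j : a 0 i < k 0 i ->
  weight (proj a) <= weight (proj (a + basis_vec i - basis_vec j)).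
Proof.
move=> aki; rewrite -(weight_exchange (proj a) i j).
exact/weight_le/proj_exchange_ge.
Qed.

Variable J : set 'rV[int]_n.

(** Above the cap k_j a unit can be taken from a for free, so adding it at an
    uncapped i would enlarge the projection. *)
Lemma maximal_exchange_capped a i j :
    Ret k J (proj a) -> J (a + basis_vec i - basis_vec j) ->
    i != j -> a 0 i < k 0 i ->
  a 0 j <= k 0 j.
Proof.
move=> [_ amax] Ja' ij aki; rewrite leNgt; apply/negP => kaj.
have le_pp' : le_vec (proj a) (proj (a + basis_vec i - basis_vec j)).
  move=> l; rewrite !proj_vecE exchangeE.
  by have [->|_] := eqVneq l i; have [?|_] := eqVneq _ j; subst; lia.
have /rowP/(_ i) : proj (a + basis_vec i - basis_vec j) = proj a.
  by apply: amax => //; exists (a + basis_vec i - basis_vec j).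
rewrite !proj_vecE exchangeE eqxx (negPf ij).
lia.
Qed.

Variables (r : nat) (JM : Mconvex_rank r J).

(** Only the projection of a has to be maximal here.  This lets b be an
    arbitrary competitor when weights are compared, and a second maximal
    element when the exchange axiom is verified. *)
Lemma proj_exchange a b i :
    J a -> J b -> Ret k J (proj a) -> proj a 0 i < proj b 0 i ->
  exists j, [/\ a 0 i < k 0 i, a 0 i < b 0 i, b 0 j < a 0 j & a 0 j <= k 0 j]
         /\ J (a + basis_vec i - basis_vec j)
         /\ J (b + basis_vec j - basis_vec i).
Proof.
case: JM => _ _ exch Ja Jb amax; rewrite !proj_vecE => pqi.
have aki : a 0 i < k 0 i by lia.
have abi : a 0 i < b 0 i by lia.
have [j [baj Ja' Jb']] := exch _ _ Ja Jb _ abi.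
rewrite addrAC in Jb'.
have ij : i != j by apply/eqP => ij; subst; lia.
exists j; split=> //; split=> //.
exact: maximal_exchange_capped Ja' ij aki.
Qed.

(** Exchanges move b towards a without lowering its projected weight, until
    its projection lies below that of a. *)
Lemma weight_proj_le_maximal a b :
    J a -> Ret k J (proj a) -> J b ->
  weight (proj b) <= weight (proj a).
Proof.
move=> Ja amax.
have [m] := ubnP (dist a b); elim: m b => // m IHm b lt_ab_m Jb.
case: (boolP [exists i, proj a 0 i < proj b 0 i]); last first.
  move=> /existsPn ba; apply: weight_le => l.
  by rewrite leNgt ba.
move=> /existsP[i pqi].
have [j [[aki abi baj ajk] [_ Jb']]] := proj_exchange Ja Jb amax pqi.
apply: le_trans (IHm _ _ Jb').
  exact/weight_proj_exchange/(lt_le_trans baj).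
by have := dist_exchange abi baj; lia.
Qed.

Lemma heaviest_maximal a : J a ->
    (forall b, J b -> weight (proj b) <= weight (proj a)) ->
  Ret k J (proj a).
Proof.
move=> Ja heavy; split; first by exists a.
by move=> _ [b Jb <-] ab; apply: le_vec_weight_eq (heavy _ Jb).
Qed.

(** Projected weights are bounded by the rank, so climbing to heavier
    projections stops. *)
Lemma Ret_nonempty : (Ret k J !=set0)%classic.
Proof.
have [[a0 Ja0] JD _] := JM.
have [m] := ubnP `|r%:Z - weight (proj a0)|%N.
elim: m a0 Ja0 => // m IHm a Ja lt_m.
have [[b [Jb ab]]|heaviest] := boolp.pselect
    (exists b, J b /\ weight (proj a) < weight (proj b)).
  have le_r : weight (proj b) <= r%:Z.
    have [_ <-] := JD _ Jb.
    by apply: weight_le => l; rewrite proj_vecE ge_min lexx.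
  by apply: (IHm b Jb); lia.
exists (proj a); apply: heaviest_maximal => // b Jb.
by rewrite leNgt; apply/negP => ab; apply: heaviest; exists b.
Qed.

(** The exchanged projection lies below that of the exchanged point, which
    cannot be heavier than the greatest weight; hence equality. *)
Lemma maximal_exchange a i j :
    J a -> Ret k J (proj a) -> a 0 i < k 0 i ->
    J (a + basis_vec i - basis_vec j) ->
  Ret k J (proj a + basis_vec i - basis_vec j).
Proof.
move=> Ja amax aki Ja'.
have heavy b := @weight_proj_le_maximal a b Ja amax.
have <- : proj (a + basis_vec i - basis_vec j)
          = proj a + basis_vec i - basis_vec j.
  apply: le_vec_weight_eq (proj_exchange_ge j aki) _.
  by rewrite weight_exchange heavy.
apply: heaviest_maximal => // b /heavy /le_trans; apply.
exact: weight_proj_exchange.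
Qed.

Lemma Ret_Mconvex : le_vec 0 k -> Mconvex (Ret k J).
Proof.
move=> k_ge0; have [_ JD _] := JM.
have [p Rp] := Ret_nonempty; have [[a Ja pE] _] := Rp; subst p.
have proj_ge0 b : J b -> le_vec 0 (proj b).
  move=> /JD[b_ge0 _] l.
  by rewrite proj_vecE le_min b_ge0 k_ge0.
have weight_ge0 : 0 <= weight (proj a).
  by apply: sumr_ge0 => l _; have := proj_ge0 _ Ja l; rewrite mxE.
exists `|weight (proj a)|%N; split; first by exists (proj a).
- move=> q Rq; have [[b Jb qE] _] := Rq; subst q.
  split; first exact: proj_ge0.
  rewrite gez0_abs //; apply: le_anti.
  by rewrite !weight_proj_le_maximal.
- move=> p q Rp' Rq i.
  have [[b Jb pE] _] := Rp'; have [[c Jc qE] _] := Rq; subst p q => pqi.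
  have [j [[bki bci cbj bjk] [Jb' Jc']]] := proj_exchange Jb Jc Rp' pqi.
  exists j; split; first by rewrite !proj_vecE; lia.
    exact: maximal_exchange.
  by rewrite addrAC; apply: maximal_exchange => //; apply: lt_le_trans bjk.
Qed.

End Retraction.

Lemma Ret_caged n (k : 'rV[int]_n) (J : set 'rV[int]_n) : caged k (Ret k J).
Proof. by move=> _ [[a _ <-] _] l; rewrite proj_vecE ge_min lexx orbT. Qed.

Theorem theorem3p5 (n : nat) (J : set 'rV[int]_n) (k : 'rV[int]_n) :
  Mconvex J -> le_vec 0 k -> Mconvex (Ret k J) /\ caged k (Ret k J).
Proof.
move=> [r JM] k_ge0; split; last exact: Ret_caged.
exact: Ret_Mconvex JM k_ge0.
Qed.
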